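(* Let $\Bbbk$ be a commutative ring. Let $M_\infty=\Bbbk\langle x_0,x_1\rangle$ be the free associative non-unital algebra in two variables $x_0,x_1$ (noncommutative polynomials without constant term), and let $\beta_\infty:M_\infty\to M_\infty$ be the unique morphism of algebras with $\beta_\infty(x_0)=x_1$ and $\beta_\infty(x_1)=x_1$. Then $(M_\infty,x_0,\beta_\infty)$ is the initial object in the category $\mathcal M_\infty$.
   Context: All algebras are associative $\Bbbk$-algebras, not necessarily unital. $\mathcal M_\infty$ is the category whose objects are triples $(A,x,\beta)$ where $A$ is an algebra, $x\in A$, and $\beta:A\to A$ is an idempotent morphism of algebras ($\beta(ab)=\beta(a)\beta(b)$ and $\beta^2=\beta$); a morphism $(A,x,\beta)\to(B,y,\gamma)$ is a morphism of algebras $f:A\to B$ with $f(x)=y$ and $f\beta=\gamma f$. *)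

(* Defs.v *)
From HB Require Import structures.
From mathcomp Require Import all_boot all_algebra.
From mathcomp Require Import finmap monalg.
From Stdlib Require Import FunctionalExtensionality ProofIrrelevance.

Set Implicit Arguments.
Unset Strict Implicit.
Unset Printing Implicit Defensive.

Import GRing.Theory.
Local Open Scope fset_scope.
Local Open Scope ring_scope.

(* Associative algebras over k, not necessarily unital. The MathComp algebra
   structures are all unital, hence the structure below. As in the rest of
   this file, k may be the zero ring.                                         *)
HB.mixin Record Lmodule_isNUAlgebra (k : comPzRingType) A
    of GRing.Lmodule k A := {
  nmul : A -> A -> A;
  nmulA : associative nmul;
  nmulDl : left_distributive nmul +%R;
  nmulDr : right_distributive nmul +%R;
  nmulZl : forall (c : k) (a b : A), nmul (c *: a) b = c *: nmul a b;
  nmulZr : forall (c : k) (a b : A), nmul a (c *: b) = c *: nmul a b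
}.

#[short(type="nuAlgType")]
HB.structure Definition NUAlgebra (k : comPzRingType) :=
  {A of GRing.Lmodule k A & Lmodule_isNUAlgebra k A}.

Section Morphisms.
Context {k : comPzRingType}.
Implicit Types A B C : nuAlgType k.

Record nuAlgHom A B := NUAlgHom {
  nuAlgHom_fun :> A -> B;
  nuAlgHom_linear : linear nuAlgHom_fun;
  nuAlgHom_mul : {morph nuAlgHom_fun : a b / nmul a b}
}.

Lemma nuAlgHom_eq A B (f g : nuAlgHom A B) : f =1 g -> f = g.
Proof.
case: f g => [f f1 f2] [g g1 g2] /= /functional_extensionality fg.
by case: g / fg g1 g2 => g1 g2; congr NUAlgHom; apply: proof_irrelevance.
Qed.

Lemma idfun_linear A : linear (fun a : A => a).
Proof. by []. Qed.

Lemma idfun_nmul A : {morph (fun a : A => a) : a b / nmul a b}.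
Proof. by []. Qed.

Definition nuAlgHom_id A : nuAlgHom A A :=
  NUAlgHom (@idfun_linear A) (@idfun_nmul A).

Lemma comp_linear A B C (f : nuAlgHom A B) (g : nuAlgHom B C) :
  linear (fun a => g (f a)).
Proof. by move=> c a b; rewrite !nuAlgHom_linear. Qed.

Lemma comp_nmul A B C (f : nuAlgHom A B) (g : nuAlgHom B C) :
  {morph (fun a => g (f a)) : a b / nmul a b}.
Proof. by move=> a b; rewrite !nuAlgHom_mul. Qed.

Definition nuAlgHom_comp A B C (f : nuAlgHom A B) (g : nuAlgHom B C) :
  nuAlgHom A C := NUAlgHom (comp_linear f g) (comp_nmul f g).
End Morphisms.

(* Composition is written in diagrammatic order. *)
Record category := Category {
  obj : Type;
  hom : obj -> obj -> Type;
  idm : forall X, hom X X;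
  compm : forall X Y Z, hom X Y -> hom Y Z -> hom X Z;
  comp1m : forall X Y (f : hom X Y), compm (idm X) f = f;
  compm1 : forall X Y (f : hom X Y), compm f (idm Y) = f;
  compmA : forall X Y Z T (f : hom X Y) (g : hom Y Z) (h : hom Z T),
    compm f (compm g h) = compm (compm f g) h
}.

Definition initial (C : category) (X : obj C) : Prop :=
  forall Y : obj C, exists! f : hom X Y, True.

Section MInfCategory.
Context (k : comPzRingType).

Record MInfObj := MkMInfObj {
  minf_alg : nuAlgType k;
  minf_pt : minf_alg;
  minf_endo : nuAlgHom minf_alg minf_alg;
  minf_idem : forall a, minf_endo (minf_endo a) = minf_endo a
}.

Record MInfHom (X Y : MInfObj) := MkMInfHom {
  minf_fun :> nuAlgHom (minf_alg X) (minf_alg Y);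
  minf_fun_pt : minf_fun (minf_pt X) = minf_pt Y;
  minf_fun_endo : forall a, minf_fun (minf_endo X a) = minf_endo Y (minf_fun a)
}.

Lemma MInfHom_eq (X Y : MInfObj) (f g : MInfHom X Y) : f =1 g -> f = g.
Proof.
case: f g => [f f1 f2] [g g1 g2] /= /nuAlgHom_eq fg.
by case: g / fg g1 g2 => g1 g2; congr MkMInfHom; apply: proof_irrelevance.
Qed.

Definition MInf_id (X : MInfObj) : MInfHom X X :=
  @MkMInfHom X X (nuAlgHom_id (minf_alg X)) erefl (fun=> erefl).

Lemma MInf_comp_pt (X Y Z : MInfObj) (f : MInfHom X Y) (g : MInfHom Y Z) :
  nuAlgHom_comp f g (minf_pt X) = minf_pt Z.
Proof. by rewrite /= !minf_fun_pt. Qed.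

Lemma MInf_comp_endo (X Y Z : MInfObj) (f : MInfHom X Y) (g : MInfHom Y Z) a :
  nuAlgHom_comp f g (minf_endo X a) = minf_endo Z (nuAlgHom_comp f g a).
Proof. by rewrite /= !minf_fun_endo. Qed.

Definition MInf_comp (X Y Z : MInfObj) (f : MInfHom X Y) (g : MInfHom Y Z) :
  MInfHom X Z := MkMInfHom (MInf_comp_pt f g) (MInf_comp_endo f g).

Lemma MInf_comp1m X Y (f : MInfHom X Y) : MInf_comp (MInf_id X) f = f.
Proof. exact: MInfHom_eq. Qed.

Lemma MInf_compm1 X Y (f : MInfHom X Y) : MInf_comp f (MInf_id Y) = f.
Proof. exact: MInfHom_eq. Qed.

Lemma MInf_compmA X Y Z T (f : MInfHom X Y) (g : MInfHom Y Z) (h : MInfHom Z T) :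
  MInf_comp f (MInf_comp g h) = MInf_comp (MInf_comp f g) h.
Proof. exact: MInfHom_eq. Qed.

Definition MInfCat : category := Category MInf_comp1m MInf_compm1 MInf_compmA.
End MInfCategory.

(* Noncommutative polynomials over k with variables in I are the finitely
   supported functions {malg k[{fmonom I}]} from the free monoid on I to k.
   The library multiplies and scales them only when k is nontrivial; pscale
   and pmul are its definitions, over any commutative ring.                   *)
Section NCPolynomials.
Context (k : comPzRingType) (I : choiceType).
Local Notation poly := {malg k[{fmonom I}]}.
Implicit Types (p q r : poly) (u v : {fmonom I}) (c : k).

Definition pscale c p : poly := \sum_(u <- msupp p) << c * p@_u *g u >>.

Definition pmul p q : poly :=
  \sum_(u <- msupp p) \sum_(v <- msupp q) << p@_u * q@_v *g mmul u v >>.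

Lemma pscaleE c p u : (pscale c p)@_u = c * p@_u.
Proof.
rewrite {2}[p]monalgE !raddf_sum mulr_sumr.
by apply/eq_bigr=> /= v _; rewrite !mcoeffU mulrnAr.
Qed.

Lemma pscaleA c d p : pscale c (pscale d p) = pscale (c * d) p.
Proof. by apply/malgP=> u; rewrite !pscaleE mulrA. Qed.

Lemma pscale1 : left_id 1 pscale.
Proof. by move=> p; apply/malgP=> u; rewrite !pscaleE mul1r. Qed.

Lemma pscaleDr : right_distributive pscale +%R.
Proof. by move=> c p q; apply/malgP=> u; rewrite !(mcoeffD, pscaleE) mulrDr. Qed.

Lemma pscaleDl p : {morph pscale^~ p : c d / c + d}.
Proof. by move=> c d; apply/malgP=> u; rewrite !(mcoeffD, pscaleE) mulrDl. Qed.

Lemma pmulw (d e : {fset {fmonom I}}) p q :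
  msupp p `<=` d -> msupp q `<=` e ->
  pmul p q = \sum_(u <- d) \sum_(v <- e) << p@_u * q@_v *g mmul u v >>.
Proof.
move=> led lee; rewrite /pmul (big_fset_incl _ led) /=.
  apply/eq_bigr=> u _; apply/big_fset_incl => // v _ /mcoeff_outdom ->.
  by rewrite mulr0 monalgU0.
move=> u _ /mcoeff_outdom pu.
by rewrite big1 => // v _; rewrite pu mul0r monalgU0.
Qed.

Lemma pmulDl : left_distributive pmul +%R.
Proof.
move=> p q r; have s := fsubset_refl (msupp r).
rewrite (pmulw (msuppD_le p q) s) (pmulw (fsubsetUl (msupp p) (msupp q)) s).
rewrite (pmulw (fsubsetUr (msupp p) (msupp q)) s) -big_split /=; apply/eq_bigr=> u _.
rewrite -big_split /=; apply/eq_bigr=> v _.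
by rewrite mcoeffD mulrDl monalgUD.
Qed.

Lemma pmulDr : right_distributive pmul +%R.
Proof.
move=> r p q; have s := fsubset_refl (msupp r).
rewrite (pmulw s (msuppD_le p q)) (pmulw s (fsubsetUl (msupp p) (msupp q))).
rewrite (pmulw s (fsubsetUr (msupp p) (msupp q))) -big_split /=; apply/eq_bigr=> u _.
rewrite -big_split /=; apply/eq_bigr=> v _.
by rewrite mcoeffD mulrDr monalgUD.
Qed.

Lemma pmul0p : left_zero 0 pmul.
Proof. by move=> p; rewrite /pmul msupp0 big_seq_fset0. Qed.

Lemma pmulp0 : right_zero 0 pmul.
Proof. by move=> p; rewrite /pmul big1 // => u _; rewrite msupp0 big_seq_fset0. Qed.

Lemma pmulUU c d u v :
  pmul << c *g u >> << d *g v >> = << c * d *g mmul u v >>.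
Proof. by rewrite (pmulw msuppU_le msuppU_le) !big_seq_fset1 !mcoeffUU. Qed.

Lemma pmul_suml (J : Type) (s : seq J) (F : J -> poly) q :
  pmul (\sum_(j <- s) F j) q = \sum_(j <- s) pmul (F j) q.
Proof. exact: (big_morph (pmul^~ q) (fun _ _ => pmulDl _ _ _) (pmul0p q)). Qed.

Lemma pmul_sumr (J : Type) (s : seq J) (F : J -> poly) p :
  pmul p (\sum_(j <- s) F j) = \sum_(j <- s) pmul p (F j).
Proof. exact: (big_morph (pmul p) (fun _ _ => pmulDr _ _ _) (pmulp0 p)). Qed.

Lemma pmulA : associative pmul.
Proof.
move=> p q r; rewrite [p]monalgE !pmul_suml; apply/eq_bigr=> u _.
rewrite [q]monalgE !(pmul_suml, pmul_sumr); apply/eq_bigr=> v _.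
rewrite [r]monalgE !pmul_sumr; apply/eq_bigr=> w _.
by rewrite !pmulUU mulrA mulmA.
Qed.

Lemma pscale_suppW c p : msupp (pscale c p) `<=` msupp p.
Proof.
apply/fsubsetP=> u; rewrite -!mcoeff_neq0 pscaleE.
by apply/contra_neq=> ->; rewrite mulr0.
Qed.

Lemma pscaleU c d u : pscale c << d *g u >> = << c * d *g u >>.
Proof. by apply/malgP=> v; rewrite pscaleE !mcoeffU mulrnAr. Qed.

Lemma pscale_sum (J : Type) (s : seq J) (F : J -> poly) c :
  pscale c (\sum_(j <- s) F j) = \sum_(j <- s) pscale c (F j).
Proof.
apply/malgP=> u; rewrite pscaleE !raddf_sum mulr_sumr.
by apply/eq_bigr=> j _; rewrite /= pscaleE.
Qed.

Lemma pmulZl c p q : pmul (pscale c p) q = pscale c (pmul p q).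
Proof.
rewrite (pmulw (pscale_suppW c p) (fsubset_refl _)) pscale_sum.
apply/eq_bigr=> u _; rewrite pscale_sum; apply/eq_bigr=> v _.
by rewrite pscaleU pscaleE mulrA.
Qed.

Lemma pmulZr c p q : pmul p (pscale c q) = pscale c (pmul p q).
Proof.
rewrite (pmulw (fsubset_refl _) (pscale_suppW c q)) pscale_sum.
apply/eq_bigr=> u _; rewrite pscale_sum; apply/eq_bigr=> v _.
by rewrite pscaleU pscaleE mulrCA.
Qed.

Lemma pmul_const p q : (pmul p q)@_mone = p@_mone * q@_mone.
Proof.
have s r : msupp r `<=` mone |` msupp r by apply: fsubsetUr.
rewrite (pmulw (s p) (s q)) raddf_sum (big_fsetD1 mone) ?fset1U1 //=.
rewrite raddf_sum (big_fsetD1 mone) ?fset1U1 //= mcoeffU mul1m eqxx.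
rewrite !big1_fset ?addr0 // => u /fsetD1P[u1 _] _; last first.
  by rewrite mcoeffU mul1m (negPf u1).
rewrite raddf_sum big1 // => v _; rewrite /= mcoeffU.
by case: eqP => // /unitm[uE]; rewrite uE eqxx in u1.
Qed.

Definition noconst : {pred poly} := fun p => p@_mone == 0.

Lemma noconst_zmod_closed : zmod_closed noconst.
Proof.
split=> [|p q]; rewrite !unfold_in ?mcoeff0 //.
by move=> /eqP p0 /eqP q0; rewrite mcoeffB p0 q0 subr0.
Qed.

HB.instance Definition _ :=
  GRing.isZmodClosed.Build poly noconst noconst_zmod_closed.

Lemma noconst_scale c p : p \in noconst -> pscale c p \in noconst.
Proof. by rewrite !unfold_in pscaleE => /eqP->; rewrite mulr0. Qed.

Lemma noconst_mul p q : p \in noconst -> pmul p q \in noconst.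
Proof. by rewrite !unfold_in pmul_const => /eqP->; rewrite mul0r. Qed.

Lemma noconst_var (i : I) : << 1 *g fmu i >> \in noconst.
Proof. by rewrite unfold_in mcoeffU fmP fmU fm1. Qed.
End NCPolynomials.

Arguments noconst {k I}.

Section FreeNUAlgebra.
Context (k : comPzRingType) (I : choiceType).

Record freeNUAlg : predArgType := FreeNUAlg {
  fpoly : {malg k[{fmonom I}]};
  fpolyP : fpoly \in noconst
}.

HB.instance Definition _ := [isSub for fpoly].
HB.instance Definition _ := [Choice of freeNUAlg by <:].
HB.instance Definition _ := [SubChoice_isSubZmodule of freeNUAlg by <:].
Implicit Types (p q r : freeNUAlg) (c : k).

Definition fscale c p : freeNUAlg := FreeNUAlg (noconst_scale c (fpolyP p)).
Definition fmul p q : freeNUAlg := FreeNUAlg (noconst_mul (fpoly q) (fpolyP p)).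
Definition fvar (i : I) : freeNUAlg := FreeNUAlg (noconst_var k i).

Lemma fscaleA c d p : fscale c (fscale d p) = fscale (c * d) p.
Proof. by apply: val_inj; exact: pscaleA. Qed.
Lemma fscale1 : left_id 1 fscale.
Proof. by move=> p; apply: val_inj; exact: pscale1. Qed.
Lemma fscaleDr : right_distributive fscale +%R.
Proof. by move=> c p q; apply: val_inj; exact: pscaleDr. Qed.
Lemma fscaleDl p : {morph fscale^~ p : c d / c + d}.
Proof. by move=> c d; apply: val_inj; exact: pscaleDl. Qed.

HB.instance Definition _ := GRing.Zmodule_isLmodule.Build k freeNUAlg
  fscaleA fscale1 fscaleDr fscaleDl.

Lemma fmulA : associative fmul.
Proof. by move=> p q r; apply: val_inj; exact: pmulA. Qed.
Lemma fmulDl : left_distributive fmul +%R.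
Proof. by move=> p q r; apply: val_inj; exact: pmulDl. Qed.
Lemma fmulDr : right_distributive fmul +%R.
Proof. by move=> p q r; apply: val_inj; exact: pmulDr. Qed.
Lemma fmulZl c p q : fmul (c *: p) q = c *: fmul p q.
Proof. by apply: val_inj; exact: pmulZl. Qed.
Lemma fmulZr c p q : fmul p (c *: q) = c *: fmul p q.
Proof. by apply: val_inj; exact: pmulZr. Qed.

HB.instance Definition _ := Lmodule_isNUAlgebra.Build k freeNUAlg
  fmulA fmulDl fmulDr fmulZl fmulZr.
End FreeNUAlgebra.

Definition M_infty (k : comPzRingType) : nuAlgType k := freeNUAlg k 'I_2.
Definition x_0 (k : comPzRingType) : M_infty k := fvar k (ord0 : 'I_2).
Definition x_1 (k : comPzRingType) : M_infty k := fvar k (ord_max : 'I_2).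

(* Main.v *)
Require Import Defs.
From mathcomp Require Import all_boot all_algebra.
From HB Require Import structures.
From mathcomp Require Import finmap monalg.

(** Everything follows from the universal property of the free non-unital
    algebra on a set [I]: a map [f] from [I] to a non-unital algebra [A] extends
    to exactly one morphism of algebras.  A noncommutative polynomial is a
    linear combination of words, so the extension must send a nonempty word
    [i1 ... in] to [f i1 * ... * f in] and be linear; this assignment is
    multiplicative because [A] is associative and because a polynomial without
    constant term involves nonempty words only, so that the absent unit of [A]
    is never called for ([freeNUAlg_ext], [freeNUAlg_hom_ext]).

    With [I] of two elements, the images of [x_0] and [x_1] thus determine a
    morphism and can be prescribed freely.  This gives the morphism [beta] with
    [x_0, x_1 |-> x_1], which is idempotent because it fixes [x_1].  Given
    another object [(A, y, gamma)], a morphism [f] to it must satisfy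
    [f x_0 = y] and [f x_1 = f (beta x_0) = gamma y], so there is at most one.
    Conversely the [f] with these two values commutes with the endomorphisms:
    [f \o beta] and [gamma \o f] agree on [x_0] by definition, and on [x_1]
    because [gamma (gamma y) = gamma y]. *)

Set Implicit Arguments.
Unset Strict Implicit.
Unset Printing Implicit Defensive.

Import GRing.Theory.
Local Open Scope fset_scope.
Local Open Scope ring_scope.

(** Makes the library lemmas on linear maps apply to morphisms of non-unital
    algebras. *)
HB.instance Definition _ (k : comPzRingType) (A B : nuAlgType k)
    (f : nuAlgHom A B) :=
  GRing.isLinear.Build k A B _ (nuAlgHom_fun f) (nuAlgHom_linear f).

(** * Extension of a map on words to polynomials *)

Section LinearExtension.
Context (k : comPzRingType) (I : choiceType) (V : lmodType k).
Variable w : {fmonom I} -> V.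
Implicit Types (p q : {malg k[{fmonom I}]}).

Definition lin_ext p : V := \sum_(u <- msupp p) p@_u *: w u.

(** The sum may run over any finite set containing the support; this lets two
    polynomials with different supports be compared. *)
Lemma lin_extw (d : {fset {fmonom I}}) p :
  msupp p `<=` d -> lin_ext p = \sum_(u <- d) p@_u *: w u.
Proof.
move=> led; apply: big_fset_incl => // u _ /mcoeff_outdom ->.
by rewrite scale0r.
Qed.

Lemma lin_extD : {morph lin_ext : p q / p + q}.
Proof.
move=> p q; rewrite (lin_extw (msuppD_le p q)).
rewrite (lin_extw (fsubsetUl (msupp p) (msupp q))).
rewrite (lin_extw (fsubsetUr (msupp p) (msupp q))) -big_split.
by apply: eq_bigr => u _; rewrite mcoeffD scalerDl.
Qed.

Lemma lin_ext_scale c p : lin_ext (pscale c p) = c *: lin_ext p.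
Proof.
rewrite (lin_extw (pscale_suppW c p)) scaler_sumr.
by apply: eq_bigr => u _; rewrite pscaleE scalerA.
Qed.

Lemma lin_extU c u : lin_ext << c *g u >> = c *: w u.
Proof. by rewrite (lin_extw msuppU_le) big_seq_fset1 mcoeffUU. Qed.

Lemma lin_ext_sum (J : Type) (s : seq J) (F : J -> {malg k[{fmonom I}]}) :
  lin_ext (\sum_(j <- s) F j) = \sum_(j <- s) lin_ext (F j).
Proof.
apply: (big_morph lin_ext lin_extD).
by rewrite /lin_ext msupp0 big_seq_fset0.
Qed.
End LinearExtension.

Lemma noconst_supp (k : comPzRingType) (I : choiceType)
    (p : {malg k[{fmonom I}]}) u :
  p \in noconst -> u \in msupp p -> u != mone.
Proof.
by rewrite unfold_in -mcoeff_neq0 => /eqP p0; apply: contra_neq => ->.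
Qed.

(** Multiplicativity is asked of nonempty words only, since no value at the
    empty word would be suitable in an algebra without unit. *)
Lemma lin_ext_mul (k : comPzRingType) (I : choiceType) (A : nuAlgType k)
    (w : {fmonom I} -> A) (p q : {malg k[{fmonom I}]}) :
  (forall u v, u != mone -> v != mone -> w (mmul u v) = nmul (w u) (w v)) ->
  p \in noconst -> q \in noconst ->
  lin_ext w (pmul p q) = nmul (lin_ext w p) (lin_ext w q).
Proof.
move=> wM p0 q0.
have nmul_suml (s : seq {fmonom I}) (F : {fmonom I} -> A) b :
    nmul (\sum_(u <- s) F u) b = \sum_(u <- s) nmul (F u) b.
  apply: (big_morph (fun a => nmul a b)) => [a a'|]; first exact: nmulDl.
  by have := nmulZl (0 : k) (0 : A) b; rewrite !scale0r.
have nmul_sumr (s : seq {fmonom I}) (F : {fmonom I} -> A) a :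
    nmul a (\sum_(u <- s) F u) = \sum_(u <- s) nmul a (F u).
  apply: (big_morph (nmul a)) => [b b'|]; first exact: nmulDr.
  by have := nmulZr (0 : k) a (0 : A); rewrite !scale0r.
rewrite /pmul lin_ext_sum {2}/lin_ext nmul_suml.
apply: eq_big_seq => u up; rewrite lin_ext_sum /lin_ext nmul_sumr.
apply: eq_big_seq => v vq; rewrite -/(lin_ext w _) lin_extU.
rewrite wM ?(noconst_supp p0 up) ?(noconst_supp q0 vq) //.
by rewrite nmulZl nmulZr scalerA.
Qed.

(** * The universal property of the free non-unital algebra *)

Section WordProduct.
Context (k : comPzRingType) (I : Type) (A : nuAlgType k).
Variable f : I -> A.

Fixpoint wprod_cons (i : I) (s : seq I) : A :=
  if s is j :: s' then nmul (f i) (wprod_cons j s') else f i.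

(** The empty word has no product without a unit; the value [0] given to it is
    one that every morphism preserves. *)
Definition wprod (s : seq I) : A := if s is i :: s' then wprod_cons i s' else 0.

Lemma wprod_cat s t :
  s <> [::] -> t <> [::] -> wprod (s ++ t) = nmul (wprod s) (wprod t).
Proof.
case: s t => [|i s] // [|j t] // _ _ /=.
by elim: s i => [|i' s IHs] i //=; rewrite IHs nmulA.
Qed.
End WordProduct.

Lemma wprod_hom (k : comPzRingType) (I : Type) (A B : nuAlgType k)
    (g : nuAlgHom A B) (f : I -> A) (s : seq I) :
  g (wprod f s) = wprod (g \o f) s.
Proof.
case: s => [|i s] /=; first exact: linear0.
by elim: s i => [|j s IHs] i //=; rewrite nuAlgHom_mul IHs.
Qed.

Lemma fmonom_neq1 (I : choiceType) (u : {fmonom I}) :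
  u != mone -> (u : seq I) <> [::].
Proof. by move=> u1 us; rewrite fmP fm1 us eqxx in u1. Qed.

Section UniversalProperty.
Context (k : comPzRingType) (I : choiceType).
Local Notation free := (freeNUAlg k I : nuAlgType k).

Section Existence.
Context (A : nuAlgType k).
Variable f : I -> A.

Definition ext_fun (p : free) : A :=
  lin_ext (fun u : {fmonom I} => wprod f u) (fpoly p).

Lemma ext_fun_linear : linear ext_fun.
Proof. by move=> c p q; rewrite /ext_fun lin_extD lin_ext_scale. Qed.

Lemma ext_fun_mul : {morph ext_fun : p q / nmul p q}.
Proof.
move=> p q; apply: lin_ext_mul (fpolyP p) (fpolyP q) => u v u1 v1.
by rewrite fmM wprod_cat //; apply: fmonom_neq1.
Qed.

Definition freeNUAlg_ext : nuAlgHom free A := NUAlgHom ext_fun_linear ext_fun_mul.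

Lemma freeNUAlg_extE i : freeNUAlg_ext (fvar k i) = f i.
Proof. by rewrite /= /ext_fun lin_extU fmU scale1r. Qed.
End Existence.

Lemma fpoly_wprod (u : {fmonom I}) :
  u != mone -> fpoly (wprod (@fvar k I : I -> free) u) = << 1 *g u >>.
Proof.
case: u => -[|i s] u1; first by case: (fmonom_neq1 u1).
elim: s i {u1} => [|j s IHs] i /=.
  by congr << 1 *g _ >>; apply/eqP; rewrite fmP fmU.
rewrite IHs pmulUU mul1r; congr << 1 *g _ >>.
by apply/eqP; rewrite fmP fmM fmU.
Qed.

Lemma freeNUAlg_words (p : free) :
  p = \sum_(u <- msupp (fpoly p)) (fpoly p)@_u *: wprod (@fvar k I : I -> free) u.
Proof.
apply: val_inj; rewrite raddf_sum /= {1}[fpoly p]monalgE.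
apply: eq_big_seq => u up /=.
by rewrite (fpoly_wprod (noconst_supp (fpolyP p) up)) pscaleU mulr1.
Qed.

(** The words span the free algebra, and the value of a morphism on a word is
    the product of its values on the letters. *)
Lemma freeNUAlg_hom_ext (A : nuAlgType k) (g h : nuAlgHom free A) :
  (forall i, g (fvar k i) = h (fvar k i)) -> g =1 h.
Proof.
move=> gh p; rewrite (freeNUAlg_words p) !linear_sum /=.
apply: eq_bigr => u _; rewrite !linearZ /= !wprod_hom.
case: (u : seq I) => [|i s] //=; congr (_ *: _).
by elim: s i => [|j s IHs] i /=; rewrite ?IHs gh.
Qed.
End UniversalProperty.

(** * Two variables *)

Lemma M_infty_hom_ext (k : comPzRingType) (A : nuAlgType k)
    (g h : nuAlgHom (M_infty k) A) :
  g (x_0 k) = h (x_0 k) -> g (x_1 k) = h (x_1 k) -> g =1 h.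
Proof.
move=> g0 g1; apply: freeNUAlg_hom_ext => i.
have [->//|i0] := eqVneq i ord0.
suff -> : i = ord_max by [].
by apply: val_inj; case: i i0 => -[|[|]].
Qed.

Lemma M_infty_hom_exists (k : comPzRingType) (A : nuAlgType k) (a0 a1 : A) :
  exists g : nuAlgHom (M_infty k) A, g (x_0 k) = a0 /\ g (x_1 k) = a1.
Proof.
exists (freeNUAlg_ext (fun i : 'I_2 => if i == ord0 then a0 else a1)).
by rewrite !freeNUAlg_extE.
Qed.

(* The existence and uniqueness of beta, and its idempotence, which the
   phrase (the unique morphism of algebras) and the claim that the triple is an
   object of the category presuppose, are part of the statement.             *)
Theorem proposition4p1 (k : comPzRingType) :
  exists beta : nuAlgHom (M_infty k) (M_infty k),
    unique (fun b : nuAlgHom (M_infty k) (M_infty k) =>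
              b (x_0 k) = x_1 k /\ b (x_1 k) = x_1 k) beta
    /\ exists beta_idem : (forall a : M_infty k, beta (beta a) = beta a),
         @initial (MInfCat k) (@MkMInfObj k (M_infty k) (x_0 k) beta beta_idem).
Proof.
have [beta [beta0 beta1]] := M_infty_hom_exists (x_1 k) (x_1 k).
exists beta; split.
  split=> // b [b0 b1]; apply: nuAlgHom_eq.
  by apply: M_infty_hom_ext; rewrite ?beta0 ?beta1 ?b0 ?b1.
have beta_idem : forall a : M_infty k, beta (beta a) = beta a.
  by apply: (@M_infty_hom_ext k _ (nuAlgHom_comp beta beta)) => /=;
    rewrite ?beta0 ?beta1.
exists beta_idem => -[A y gamma gamma_idem].
have [f [f0 f1]] := M_infty_hom_exists y (gamma y).
have f_endo : forall a : M_infty k, f (beta a) = gamma (f a).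
  apply: (@M_infty_hom_ext k _ (nuAlgHom_comp beta f) (nuAlgHom_comp f gamma)).
    by rewrite /= beta0 f0 f1.
  by rewrite /= beta1 f1 gamma_idem.
pose X := MkMInfObj (x_0 k) beta_idem; pose Y := MkMInfObj y gamma_idem.
exists (@MkMInfHom k X Y f f0 f_endo); split=> // g _.
apply: MInfHom_eq; apply: M_infty_hom_ext => /=.
  by rewrite f0 (minf_fun_pt g).
have /= g_x1 := minf_fun_endo g (x_0 k).
by rewrite f1 -beta0 g_x1 (minf_fun_pt g).
Qed.
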